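(* Let $\mu=\sum_{n=0}^\infty\mu(n)\delta_n$ be the dilogarithm distribution, i.e. the probability on $\mathbb{N}=\{0,1,2,\ldots\}$ defined by $\sum_{n=0}^{\infty}\mu(n)z^n=\exp\big(\sum_{n=1}^{\infty}\frac{z^n-1}{n^2}\big)$ for $|z|\le1$, and let $\eta=N(0,1)*\mu$ be its convolution with the standard Gaussian distribution. Then the exponential family $F(\eta)$ generated by $\eta$ has domain of the means $\mathbb{R}$ and variance function $$V_{F(\eta)}(m)=e^m+1,\qquad m\in\mathbb{R}.$$
   Context: For a positive measure $\eta$ on $\mathbb{R}$ not concentrated on one point let $B_\eta(s)=\int_{\mathbb{R}}e^{-sx}\eta(dx)$, let $S(\eta)$ be the interior of $\{s: B_\eta(s)<\infty\}$ (assumed nonempty), and $\ell_\eta=\log B_\eta$. The exponential family generated by $\eta$ is $F(\eta)=\{e^{-sx-\ell_\eta(s)}\eta(dx): s\in S(\eta)\}$; the mean of the member indexed by $s$ is $m=-\ell'_\eta(s)$; the domain of the means is $M_{F(\eta)}=-\ell'_\eta(S(\eta))$; with $\varphi_\eta$ the inverse of $s\mapsto-\ell'_\eta(s)$, the variance function is $V_{F(\eta)}(m)=\ell''_\eta(\varphi_\eta(m))$, the variance of the member of $F(\eta)$ with mean $m$. *)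

(* Defs.v *)
From HB Require Import structures.
From mathcomp Require Import all_boot all_order all_algebra.
From mathcomp Require Import all_classical all_reals all_analysis.
From mathcomp Require Import complex.

Set Implicit Arguments.
Unset Strict Implicit.
Unset Printing Implicit Defensive.

Import Order.TTheory GRing.Theory Num.Theory.
Import numFieldNormedType.Exports.

Local Open Scope classical_set_scope.
Local Open Scope ring_scope.

(* Borel measures are carried by [measurableTypeR R], as [normal_prob] is,
   rather than by [R], whose (identical) Borel sigma-algebra has a different
   display. *)

(* The exponential family generated by eta consists of the probabilities
   exp(- s x - log_laplace s) eta(dx), for s in laplace_dom. *)
Section exponential_family.
Context {R : realType}.
Variable eta : {measure set (measurableTypeR R) -> \bar R}.

Definition laplace (s : R) : \bar R := (\int[eta]_x (expR (- (s * x)))%:E)%E.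

Definition laplace_dom : set R := interior [set s | (laplace s < +oo)%E].

Definition log_laplace (s : R) : R := ln (fine (laplace s)).

(* the mean of the member of the family indexed by s *)
Definition family_mean (s : R) : R := - (log_laplace^`())%classic s.

Definition mean_domain : set R := family_mean @` laplace_dom.

(* [family_mean] is injective on [laplace_dom] when eta is not concentrated on
   one point, and [mean_inv] is then its inverse on [mean_domain]; the values
   of [mean_inv] outside [mean_domain] are irrelevant. *)
Definition mean_inv : R -> R := pinv laplace_dom family_mean.

(* meaningful for m in [mean_domain] only *)
Definition variance_function (m : R) : R :=
  (log_laplace^`(2))%classic (mean_inv m).

End exponential_family.

Section convolution.
Context {R : realType}.
Local Notation RT := (measurableTypeR R).

Definition addR (xy : RT * RT) : RT := (xy.1 : R) + (xy.2 : R).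

Lemma measurable_addR : measurable_fun [set: RT * RT] addR.
Proof.
exact: (@measurable_realfun.measurable_funD _ (RT * RT)%type R setT fst snd
  (@measurable_fst _ _ RT RT) (@measurable_snd _ _ RT RT)).
Qed.

HB.instance Definition _ :=
  isMeasurableFun.Build _ _ _ _ addR measurable_addR.

Definition convolution (P Q : probability RT R) : probability RT R :=
  distribution (P \x Q)%E addR.

End convolution.

Section dilogarithm.
Context {R : realType}.

Definition cexp (z : R[i]) : R[i] :=
  Complex (expR (complex.Re z) * cos (complex.Im z))
          (expR (complex.Re z) * sin (complex.Im z)).

(* The topology on R[i] is the one of the numFieldType R[i], carried by its
   regular module R[i]^o. *)
Definition has_csum (u : nat -> R[i]) (l : R[i]) : Prop :=
  series (u : (R[i]^o)^nat) @ \oo --> (l : R[i]^o).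

(* The first sum is shifted, so as to run over n >= 1. *)
Definition dilogarithm_distribution (mu : probability nat R) : Prop :=
  forall z : R[i], `|z| <= 1 ->
    exists2 l : R[i], has_csum (fun n => (z ^+ n.+1 - 1) / n.+1%:R ^+ 2) l
      & has_csum (fun n => (fine (mu [set n]))%:C%C * z ^+ n) (cexp l).

Definition real_of_nat (n : nat) : measurableTypeR R := n%:R : R.

Lemma measurable_real_of_nat : measurable_fun [set: nat] real_of_nat.
Proof. by []. Qed.

HB.instance Definition _ :=
  isMeasurableFun.Build _ _ _ _ real_of_nat measurable_real_of_nat.

(* mu seen as the probability on the line giving mass mu {n} to n *)
Definition on_real_line (mu : probability nat R) :
    probability (measurableTypeR R) R :=
  distribution mu real_of_nat.

End dilogarithm.

(* Main.v *)
Require Import Defs.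
From mathcomp Require Import all_boot all_order all_algebra.
From mathcomp Require Import all_classical all_reals all_analysis.
From mathcomp Require Import measurable_realfun complex ring lra.

Import Order.TTheory GRing.Theory Num.Theory.
Import numFieldNormedType.Exports.

Local Open Scope classical_set_scope.
Local Open Scope ring_scope.

(** With z = e^-s, the Laplace transform of eta = N(0,1) * mu at s is
    e^(s^2/2) times the generating function of mu at z.  For 0 < z < 1 the
    latter is exp (Li_2(z) - Li_2(1)), where Li_2 is the dilogarithm, so that
<<
      l(s) = s^2/2 + Li_2(e^-s) - Li_2(1)              for s > 0.
>>
    Termwise differentiation of power series gives z Li_2'(z) = Li_1(z) and
    Li_1(z) = - ln (1 - z) ([polylog1E]), hence
<<
      l'(s) = s + ln (1 - e^-s) = ln (e^s - 1),
      l''(s) = e^s / (e^s - 1).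
>>
    The mean - ln (e^s - 1) takes each real value m exactly once on
    s > 0, at s = ln (1 + e^-m), and there l''(s) = e^m + 1.

    The other half of the argument is that the domain of the family is exactly
    s > 0: the Laplace transform must be infinite for every s < 0.  A finite
    value at some s < 0 would give mu a finite mean, whereas the derivative of
    its generating function blows up logarithmically at 1.  This is
    [dilogarithm_infinite_mean], an elementary comparison with the harmonic
    series. *)

(** * The generating function at real points *)

Section real_points.
Context {R : realType}.

Lemma has_csum_Re (u : nat -> R[i]) (l : R[i]) :
  has_csum u l -> series (fun n => complex.Re (u n)) @ \oo --> complex.Re l.
Proof.
move=> /cvgrPdist_lt ul; apply/cvgrPdist_lt => e e0.
have /ul : (0 : R[i]) < e%:C%C by rewrite ltcR.
apply: filterS => n /= un; rewrite -ltcR; apply: le_lt_trans un.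
rewrite (_ : _ - _ = complex.Re (l - series (u : (R[i]^o)^nat) n)).
  exact: normc_ge_Re.
have ReD : {morph @complex.Re R : x y / x + y} by case=> ? ? [].
rewrite /series/= -(big_morph _ ReD (erefl : complex.Re 0 = 0)).
by case: l {ul} (\sum_(0 <= _ < n) _) => ? ? [].
Qed.

(** The imaginary parts of the partial sums vanish, and limits are unique. *)
Lemma has_csum_real (u : nat -> R) (l : R[i]) :
  has_csum (fun n => (u n)%:C%C) l -> l = (complex.Re l)%:C%C.
Proof.
move=> ul; have := has_csum_Re _ _ ul; rewrite /= => ulR.
have ulC : has_csum (fun n => (u n)%:C%C) (complex.Re l)%:C%C.
  apply/cvgrPdist_lt => e e0.
  have eE : e = (complex.Re e)%:C%C.
    by move: e0; rewrite ltcE => /andP[/eqP/= ei _]; case: e ei => a b /= ->.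
  rewrite eE ltcR in e0.
  move/cvgrPdist_lt : ulR => /(_ _ e0); apply: filterS => n.
  rewrite eE /series /= -rmorph_sum -rmorphB normc_def /=.
  by rewrite expr0n addr0 sqrtr_sqr ltcR.
exact: (cvg_unique _ ul ulC).
Qed.

(** For a real argument the exponent l is real, so that [cexp l] is the real
    exponential. *)
Lemma dilogarithm_real (mu : probability nat R) (x : R) :
  dilogarithm_distribution mu -> 0 <= x <= 1 ->
  exists2 l : R, series (fun n => (x ^+ n.+1 - 1) / n.+1%:R ^+ 2) @ \oo --> l
    & series (fun n => fine (mu [set n]) * x ^+ n) @ \oo --> expR l.
Proof.
move=> dmu /andP[x0 x1]; have [|l] := dmu (x%:C)%C.
  by rewrite normc_def/= expr0n addr0 sqrtr_sqr ger0_norm// lecR.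
rewrite (_ : (fun n => _) =
    fun n => ((x ^+ n.+1 - 1) / n.+1%:R ^+ 2)%:C%C); last first.
  apply/funext => n; rewrite rmorphM rmorphB fmorphV !rmorphXn.
  by rewrite rmorph_nat rmorph1.
rewrite [X in has_csum X (cexp l)](_ : _ =
    fun n => (fine (mu [set n]) * x ^+ n)%:C%C); last first.
  by apply/funext => n; rewrite rmorphM rmorphXn.
move=> ul; have lE := has_csum_real _ _ ul.
move/has_csum_Re : ul => /= ul /has_csum_Re/= ml.
by exists (complex.Re l) => //; rewrite lE /= cos0 mulr1 in ml.
Qed.

End real_points.

(** * Laplace transforms *)

Section laplace_transforms.
Context {R : realType}.

(** The density agrees almost everywhere with the Radon-Nikodym derivative, for
    which the change of variables is known. *)
Lemma ge0_integral_normal_prob (m sigma : R) (f : measurableTypeR R -> \bar R) :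
  measurable_fun setT f -> (forall x, (0 <= f x)%E) ->
  (\int[normal_prob m sigma]_x f x =
   \int[lebesgue_measure]_x (f x * (normal_pdf m sigma x)%:E))%E.
Proof.
move=> mf f0.
have dom := normal_prob_dominates m sigma.
have intpdf := integrable_normal_pdf m sigma.
rewrite -(Radon_Nikodym_SigmaFinite.change_of_variables dom)//.
have intRN := Radon_Nikodym_SigmaFinite.f_integrable dom.
apply: ae_eq_integral => //.
- by apply: emeasurable_funM => //; exact: measurable_int intRN.
- by apply: emeasurable_funM => //; exact: measurable_int intpdf.
- apply: ae_eqe_mul2l; apply: integral_ae_eq => //.
  + exact: measurable_int intpdf.
  + by move=> E _ mE; rewrite -(Radon_Nikodym_SigmaFinite.f_integral dom).
Qed.

Lemma measurable_laplace_kernel (s : R) :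
  measurable_fun [set: measurableTypeR R] (fun x => (expR (- (s * x)))%:E).
Proof.
apply/measurable_EFinP; apply: measurableT_comp => //=.
by apply: measurableT_comp => //=; exact: measurable_funM.
Qed.

Lemma laplace_kernel_ge0 (s : R) (x : measurableTypeR R) :
  (0 <= (expR (- (s * x)))%:E)%E.
Proof. by rewrite lee_fin expR_ge0. Qed.

(** Completing the square, e^(-sx) times the density of N(0,1) is e^(s^2/2)
    times the density of N(-s,1). *)
Lemma laplace_normal_prob (s : R) :
  laplace (normal_prob 0 1) s = (expR (s ^+ 2 / 2))%:E.
Proof.
rewrite /laplace ge0_integral_normal_prob; last 2 first.
- exact: measurable_laplace_kernel.
- exact: laplace_kernel_ge0.
transitivity (\int[lebesgue_measure]_x ((expR (s ^+ 2 / 2))%:E *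
    (normal_pdf (- s) 1 x)%:E))%E.
  apply: eq_integral => x _; rewrite -!EFinM; congr EFin.
  rewrite !normal_pdfE ?oner_eq0// /normal_fun.
  rewrite mulrCA [RHS]mulrCA -!expRD; congr (_ * expR _).
  by field.
rewrite ge0_integralZl//; last 2 first.
- by apply/measurable_EFinP; exact: measurable_normal_pdf.
- by move=> x _; rewrite lee_fin normal_pdf_ge0.
by rewrite integral_normal_pdf mule1.
Qed.

Lemma ge0_integral_nat (mu : probability nat R) (f : nat -> R) :
  (forall n, 0 <= f n) ->
  (\int[mu]_n (f n)%:E = \sum_(n <oo) (fine (mu [set n]) * f n)%:E)%E.
Proof.
move=> f0.
have <- : \bigcup_(k : nat) [set k] = setT.
  by apply/seteqP; split=> // n _; exists n.
rewrite ge0_integral_bigcup//; last 2 first.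
- by move=> n _; rewrite lee_fin.
- by apply/trivIsetP => i j _ _ ij; apply/seteqP; split=> // x /= [-> /eqP];
    rewrite (negbTE ij).
apply: eq_eseriesr => n _.
rewrite EFinM fineK ?fin_num_measure//.
rewrite (eq_integral (cst (f n)%:E)); last by move=> x /[!inE] ->.
by rewrite integral_cst// muleC.
Qed.

Lemma laplace_convolution (P Q : probability (measurableTypeR R) R) (s : R) :
  (laplace (convolution P Q) s = laplace P s * laplace Q s)%E.
Proof.
have mexp := measurable_laplace_kernel s.
have exp0 := laplace_kernel_ge0 s.
rewrite /laplace /convolution ge0_integral_distribution//.
rewrite fubini_tonelli1//; last 2 first.
- exact: measurableT_comp.
- by move=> x; exact: exp0.
transitivity (\int[P]_x ((expR (- (s * x)))%:E * laplace Q s))%E.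
  apply: eq_integral => x _; rewrite /fubini_F -ge0_integralZl//.
  apply: eq_integral => y _.
  by rewrite /= /addR/= -EFinM -expRD mulrDr opprD.
rewrite ge0_integralZr//.
by apply: integral_ge0.
Qed.

Lemma laplace_on_real_line (mu : probability nat R) (s : R) :
  (laplace (on_real_line mu) s =
   \sum_(n <oo) (fine (mu [set n]) * expR (- s) ^+ n)%:E)%E.
Proof.
rewrite /laplace /on_real_line ge0_integral_distribution; last 2 first.
- exact: measurable_laplace_kernel.
- exact: laplace_kernel_ge0.
transitivity (\int[mu]_n (expR (- s) ^+ n)%:E)%E.
  apply: eq_integral => n _ /=.
  by rewrite /real_of_nat -mulNr expRM_natr.
by rewrite ge0_integral_nat// => n; rewrite exprn_ge0// expR_ge0.
Qed.

End laplace_transforms.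

(** * The derivative of the dilogarithm *)

Section polylogarithm.
Context {R : realType}.
Implicit Types (c : nat -> R) (x s : R).

(** Comparison with the series of (n+1) |x|^n, whose partial sums have the
    closed form (1 - |x|^n (1 + n (1 - |x|))) / (1 - |x|)^2. *)
Lemma is_cvg_pseries_linear c x :
  (forall n, `|c n| <= n.+1%:R) -> `|x| < 1 -> cvgn (pseries c x).
Proof.
move=> cn x1; apply: normed_cvg.
have x'0 : 0 < 1 - `|x| by rewrite subr_gt0.
have cvg_arith : cvgn (series (fun n => n.+1%:R * `|x| ^+ n)).
  apply: nondecreasing_is_cvgn.
    apply: nondecreasing_series => n _ _.
    by rewrite mulr_ge0// exprn_ge0.
  exists (1 / (1 - `|x|) ^+ 2) => _ [n _ <-].
  rewrite ler_pdivlMr ?exprn_gt0//.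
  have -> : series (fun n => n.+1%:R * `|x| ^+ n) n * (1 - `|x|) ^+ 2 =
      1 - `|x| ^+ n * (1 + n%:R * (1 - `|x|)).
    rewrite /series/=; elim: n => [|n IH].
      by rewrite big_nil expr0; ring.
    by rewrite big_nat_recr//= mulrDl IH -natr1 (exprS _ n); ring.
  rewrite gerBl mulr_ge0 ?exprn_ge0// addr_ge0// mulr_ge0//.
  exact: ltW.
apply: series_le_cvg cvg_arith => n /=.
- exact: normr_ge0.
- by rewrite mulr_ge0// exprn_ge0.
- by rewrite normrM normrX ler_wpM2r// exprn_ge0.
Qed.

(** For k > 0 this vanishes at n = 0, since 0^-1 = 0, so that the sum defining
    Li_k can start from n = 0. *)
Definition polylog_coef k n : R := n%:R ^- k.

Definition polylog k x : R := limn (pseries (polylog_coef k) x).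

Lemma norm_invSn_exp_le k n : `|n.+1%:R ^- k : R| <= 1.
Proof.
rewrite ger0_norm ?invr_ge0 ?exprn_ge0//.
by rewrite invf_le1 ?exprn_gt0 ?exprn_ege1 ?ler1n.
Qed.

Lemma pseries_diffs_polylog k :
  pseries_diffs (polylog_coef k.+1) = (fun n => n.+1%:R ^- k).
Proof.
apply/funext => n; rewrite /pseries_diffs /polylog_coef.
by rewrite exprS invfM mulrA divff ?mul1r// pnatr_eq0.
Qed.

Lemma polylog_coef_le k n : `|polylog_coef k.+1 n| <= 1.
Proof.
rewrite /polylog_coef; case: n => [|n].
  by rewrite expr0n/= invr0 normr0.
exact: norm_invSn_exp_le.
Qed.

Lemma is_cvg_polylog k x : `|x| < 1 -> cvgn (pseries (polylog_coef k.+1) x).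
Proof.
apply: is_cvg_pseries_linear => n.
by rewrite (le_trans (polylog_coef_le k n))// ler1n.
Qed.

(** The derived series, which is Li_k(x) / x, is kept as a power series so that
    the formula also holds at x = 0. *)
Lemma is_derive_polylog k x : `|x| < 1 ->
  is_derive x (1 : R) (polylog k.+1)
    (limn (pseries (fun n => n.+1%:R ^- k) x)).
Proof.
move=> x1; rewrite -pseries_diffs_polylog.
(* Termwise differentiation at x requires convergence at some K > |x|. *)
pose K := (1 + `|x|) / 2.
have K0 : 0 <= K by rewrite /K divr_ge0// addr_ge0.
have K1 : `|K| < 1 by rewrite ger0_norm// /K; lra.
apply: (@pseries_snd_diffs _ _ K).
- exact: is_cvg_polylog.
- apply: is_cvg_pseries_linear => // n; rewrite pseries_diffs_polylog.
  by rewrite (le_trans (norm_invSn_exp_le _ _))// ler1n.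
- apply: is_cvg_pseries_linear => // n; rewrite pseries_diffs_polylog.
  rewrite /pseries_diffs normrM [`|_.+1%:R|]ger0_norm// ler_piMr//.
  exact: norm_invSn_exp_le.
- by rewrite [`|K|]ger0_norm// /K; lra.
Qed.

Lemma pseries_polylogS k x n :
  pseries (polylog_coef k.+1) x n.+1 =
  \sum_(0 <= i < n) x ^+ i.+1 / i.+1%:R ^+ k.+1.
Proof.
rewrite /pseries /series /= big_nat_recl//.
rewrite {1}/polylog_coef expr0n invr0 mul0r add0r.
by apply: eq_bigr => i _; rewrite /polylog_coef mulrC.
Qed.

Lemma polylog_shift k x : `|x| < 1 ->
  x * limn (pseries (fun n => n.+1%:R ^- k.+1) x) = polylog k.+1 x.
Proof.
move=> x1; apply/esym/cvg_lim => //; rewrite -cvg_shiftS.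
rewrite (_ : (fun n => _) =
    (fun n => x * pseries (fun n => n.+1%:R ^- k.+1) x n)); last first.
  apply/funext => n; rewrite pseries_polylogS big_distrr/=.
  apply: eq_bigr => i _; rewrite (exprS x) -mulrA; congr (_ * _).
  exact: mulrC.
apply: cvgM; first exact: cvg_cst.
apply: is_cvg_pseries_linear => // n.
by rewrite (le_trans (norm_invSn_exp_le _ _))// ler1n.
Qed.

(** Both sides vanish at 0, and both have derivative 1 / (1 - y), the sum of
    the geometric series. *)
Lemma polylog1E x : 0 < x < 1 -> polylog 1 x = - ln (1 - x).
Proof.
move=> /andP[x0 x1].
have bnd y : y \in `[0, x] -> `|y| < 1.
  by rewrite in_itv/= => /andP[y0 yx]; rewrite ger0_norm// (le_lt_trans yx).
pose f y := polylog 1 y + ln (1 - y).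
have der y : y \in `[0, x] -> is_derive y (1 : R) f 0.
  move=> y0x; have y1 := bnd _ y0x.
  have y'0 : 0 < 1 - y by rewrite subr_gt0 (le_lt_trans (ler_norm _)).
  have d1 := is_derive_polylog 0 _ y1.
  have geo : limn (pseries (fun n => n.+1%:R ^- 0) y) = (1 - y)^-1.
    apply/cvg_lim => //; rewrite -[(1 - y)^-1]mul1r.
    rewrite (_ : pseries _ y = series (geometric 1 y)); last first.
      by apply/funext => n; rewrite /pseries/series/=; apply: eq_bigr => i _;
        rewrite expr0 invr1.
    exact: cvg_geometric_series.
  rewrite geo in d1.
  have d2 : is_derive y (1 : R) (@ln R \o (fun y => 1 - y)) ((1 - y)^-1 * (-1)).
    apply: is_derive1_comp; first exact: is_derive1_ln.
    by rewrite -[X in is_derive _ _ _ X]sub0r; exact: is_deriveB.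
  by have := is_deriveD d1 d2; rewrite mulrN1 subrr; exact.
have p0 : polylog 1 0 = 0 by rewrite -polylog_shift ?normr0// mul0r.
have derf y : y \in `]0, x[ -> is_derive y (1 : R) f ((fun=> 0) y).
  by move=> /subset_itv_oo_cc; exact: der.
have contf : {within `[0, x], continuous f}.
  apply: continuous_in_subspaceT => y /[!inE] /der yd.
  by apply/differentiable_continuous/derivable1_diffP; case: yd.
have [z _] := MVT x0 derf contf.
rewrite /f p0 subr0 ln1 addr0 mul0r subr0 => /eqP.
by rewrite addr_eq0 => /eqP.
Qed.

Lemma is_derive_dilog_expR s : 0 < s ->
  is_derive s (1 : R) (fun s => polylog 2 (expR (- s))) (ln (1 - expR (- s))).
Proof.
move=> s0; have e1 : expR (- s) < 1 by rewrite expR_lt1 oppr_lt0.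
have ne1 : `|expR (- s)| < 1 by rewrite ger0_norm// expR_ge0.
have d1 := is_derive_polylog 1 _ ne1.
have d2 : is_derive s (1 : R) (@expR R \o -%R) (expR (- s) * (-1)).
  exact: is_derive1_comp.
have := @is_derive1_comp _ (polylog 2) (@expR R \o -%R) _ _ _ d1 d2.
rewrite mulrN1 mulrN mulrC polylog_shift// polylog1E ?opprK//.
by rewrite expR_gt0.
Qed.

End polylogarithm.

(** * The Laplace transform of the convolution *)

Section dilogarithm_family.
Context {R : realType}.
Variable mu : probability nat R.
Hypothesis dmu : dilogarithm_distribution mu.

(** The constant a is - Li_2(1): it is the exponent at z = 0, and is left
    unevaluated because only the derivatives of the exponent matter. *)
Lemma dilogarithm_gf : exists a : R, forall x : R, 0 <= x < 1 ->
  series (fun n => fine (mu [set n]) * x ^+ n) @ \oo --> expR (a + polylog 2 x).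
Proof.
have [|a ca _] := dilogarithm_real mu 0 dmu; first by rewrite lexx ler01.
exists a => x /andP[x0 x1].
have [|l cl] := dilogarithm_real mu x dmu; first by rewrite x0 ltW.
suff -> : l = a + polylog 2 x by [].
apply/eqP; rewrite addrC -subr_eq; apply/eqP/esym/cvg_lim => //.
rewrite -cvg_shiftS.
rewrite [X in X @ _](_ : _ =
    (series (fun n => (x ^+ n.+1 - 1) / n.+1%:R ^+ 2) \-
     series (fun n => (0 ^+ n.+1 - 1) / n.+1%:R ^+ 2))); last first.
  apply/funext => n; rewrite -[LHS]/(pseries (polylog_coef 2) x n.+1).
  rewrite pseries_polylogS /series/= -sumrB.
  by apply: eq_bigr => i _; rewrite expr0n -mulrBl; congr (_ / _) => /=; ring.
exact: cvgB.
Qed.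

(** 1 - e^-y >= y/2 for 0 <= y <= 1, applied to y = (n+1)/(N+1) for n <= N. *)
Lemma dilogarithm_exponent_le (N : nat) (l : R) :
  series (fun n => (expR (- N.+1%:R^-1) ^+ n.+1 - 1) / n.+1%:R ^+ 2)
    @ \oo --> l ->
  l <= - (N.+1%:R^-1 / 2 * series (@harmonic R) N.+1).
Proof.
set s := N.+1%:R^-1 => cl.
have s0 : 0 < s by rewrite invr_gt0.
have e1 : expR (- s) <= 1 by rewrite expR_le1 oppr_le0 ltW.
apply: (@le_trans _ _
    (series (fun n => (expR (- s) ^+ n.+1 - 1) / n.+1%:R ^+ 2) N.+1)).
  rewrite -(cvg_lim _ cl)//; apply: nonincreasing_cvgn_ge; last first.
    by apply/cvg_ex; eexists; exact: cl.
  move=> m n mn; rewrite -lerN2 /series/= -!sumrN.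
  apply: (@nondecreasing_series _ _ xpredT 0%N) mn => i _ _.
  by rewrite -mulNr divr_ge0// oppr_ge0 subr_le0 exprn_ile1 ?expR_ge0.
rewrite /series/= big_distrr/= -sumrN; apply: ler_sum_nat => n /andP[_ nN].
rewrite /harmonic -expRM_natr.
set y := s * n.+1%:R.
have y0 : 0 < y by rewrite mulr_gt0.
have y1 : y <= 1 by rewrite /y /s mulrC ler_pdivrMr// mul1r ler_nat.
rewrite mulNr -/y ler_pdivrMr ?exprn_gt0//.
have -> : - (s / 2 * n.+1%:R^-1) * n.+1%:R ^+ 2 = - (y / 2).
  by rewrite /y; field; rewrite ?nat1r ?natr1 pnatr_eq0.
have y2 : 0 < 1 + y by rewrite addr_gt0.
have : expR (- y) <= (1 + y)^-1.
  by rewrite expRN lef_pV2 ?posrE ?expR_gt0// expR_ge1Dx.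
suff : (1 + y)^-1 <= 1 - y / 2 by lra.
by rewrite -[leLHS]mul1r ler_pdivrMr//; nra.
Qed.

(** e^(-sn) >= 1 - sn for every n. *)
Lemma dilogarithm_gf_ge (C s l : R) :
  (forall N, \sum_(0 <= n < N) fine (mu [set n]) * n%:R <= C) -> 0 < s ->
  series (fun n => fine (mu [set n]) * expR (- s) ^+ n) @ \oo --> l ->
  1 - s * C <= l.
Proof.
move=> meanC s0 cl.
(* At z = 1 every term of the exponent is 0, so that mu has total mass 1. *)
have [|z cz c1] := dilogarithm_real mu 1 dmu; first by rewrite lexx ler01.
have z0 : z = 0.
  apply: (cvg_unique _ cz) => //.
  rewrite [X in X @ _](_ : _ = fun=> 0); first exact: cvg_cst.
  apply/funext => n; rewrite /series/=; apply: big1 => i _.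
  by rewrite expr1n subrr mul0r.
rewrite z0 expR0 in c1.
have c1' : series (fun n => fine (mu [set n]) * 1 ^+ n) n - s * C
    @[n --> \oo] --> 1 - s * C.
  by apply: cvgB => //; exact: cvg_cst.
rewrite -(cvg_lim _ c1')// -(cvg_lim _ cl)//; apply: ler_lim.
- by apply/cvg_ex; eexists; exact: c1'.
- by apply/cvg_ex; eexists; exact: cl.
near=> N; rewrite /series/= lerBlDr -lerBlDl.
apply: le_trans (_ : s * \sum_(0 <= n < N) fine (mu [set n]) * n%:R <= _);
  last by rewrite ler_wpM2l// ltW.
rewrite -sumrB big_distrr/=; apply: ler_sum => n _.
rewrite expr1n -mulrBr mulrCA ler_wpM2l ?fine_ge0//.
rewrite -expRM_natr; have := expR_ge1Dx (- s * n%:R).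
by rewrite mulNr; lra.
Unshelve. all: by end_near. Qed.

(** If the mean were at most C, then with s = 1/(N+1) and H the partial sum
    of the harmonic series, the two preceding estimates would give
    1 - s C <= e^(- s H / 2) <= 1 / (1 + s H / 2), so that H <= 4 C for all
    large N, against the divergence of the harmonic series. *)
Lemma dilogarithm_infinite_mean (C : R) :
  exists N, C < \sum_(0 <= n < N) fine (mu [set n]) * n%:R.
Proof.
apply: contrapT => /forallNP/= meanC.
have {}meanC N : \sum_(0 <= n < N) fine (mu [set n]) * n%:R <= C.
  by rewrite leNgt; apply/negP/meanC.
have C0 : 0 <= C by have := meanC 0%N; rewrite big_nil.
pose H n : R := series (@harmonic R) n.
have H0 n : 0 <= H n by apply: sumr_ge0 => i _; exact: harmonic_ge0.
(* The bound 2 C <= N + 1 makes s * C at most 1/2. *)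
have Hbound N : 2 * C <= N.+1%:R -> H N.+1 <= 4 * C.
  move=> CN; set s := N.+1%:R^-1 : R.
  have s0 : 0 < s by rewrite invr_gt0.
  have [|l cl cg] := dilogarithm_real mu (expR (- s)) dmu.
    by rewrite expR_ge0 expR_le1 oppr_le0 ltW.
  have h1 := dilogarithm_gf_ge _ _ _ meanC s0 cg.
  have h2 := dilogarithm_exponent_le _ _ cl.
  have h3 : expR l <= (1 + s / 2 * H N.+1)^-1.
    rewrite (@le_trans _ _ (expR (- (s / 2 * H N.+1))))// ?ler_expR//.
    rewrite expRN lef_pV2 ?posrE ?expR_gt0// ?expR_ge1Dx//.
    by rewrite ltr_pwDl// !mulr_ge0// ltW.
  have h4 : (1 - s * C) * (1 + s / 2 * H N.+1) <= 1.
    rewrite -ler_pdivlMr; last by rewrite ltr_pwDl// !mulr_ge0// ltW.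
    by rewrite mul1r (le_trans h1).
  have sC : s * C <= 1 / 2.
    by rewrite /s mulrC ler_pdivrMr//; lra.
  have h5 : s * (H N.+1 / 2 * (1 - s * C)) <= s * C.
    by move: h4; rewrite (_ : (1 - s * C) * (1 + s / 2 * H N.+1) =
      1 - s * C + s * (H N.+1 / 2 * (1 - s * C))); [lra|field].
  rewrite ler_pM2l// in h5.
  have := H0 N.+1; nra.
apply: (@dvg_harmonic R); apply: nondecreasing_is_cvgn.
  by apply: nondecreasing_series => n _ _; exact: harmonic_ge0.
exists (4 * C) => _ [n _ <-].
pose N := maxn n (Num.truncn (2 * C)).+1.
apply: (@le_trans _ _ (H N.+1)).
  apply: (@nondecreasing_series _ _ xpredT 0%N) => [i _ _|].
    exact: harmonic_ge0.
  by rewrite leqW// leq_maxl.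
apply: Hbound; rewrite ltW// (lt_le_trans (truncnS_gt _))// ler_nat.
by rewrite leqW// leq_maxr.
Qed.

Let eta := convolution (normal_prob 0 1) (on_real_line mu).

Lemma laplace_dilogarithm (s : R) :
  laplace eta s = ((expR (s ^+ 2 / 2))%:E *
    \sum_(n <oo) (fine (mu [set n]) * expR (- s) ^+ n)%:E)%E.
Proof.
by rewrite laplace_convolution laplace_on_real_line laplace_normal_prob.
Qed.

Lemma laplace_dilogarithm_pos : exists a : R, forall s : R, 0 < s ->
  laplace eta s = (expR (s ^+ 2 / 2 + (a + polylog 2 (expR (- s)))))%:E.
Proof.
have [a ha] := dilogarithm_gf; exists a => s s0.
rewrite laplace_dilogarithm expRD EFinM; congr (_ * _)%E.
apply/cvg_lim => //.
have /ha gf : 0 <= expR (- s) < 1 by rewrite expR_ge0 expR_lt1 oppr_lt0.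
apply: cvg_EFin; first by apply: nearW => n; rewrite sumEFin.
rewrite [X in X @ _](_ : _ =
  series (fun n => fine (mu [set n]) * expR (- s) ^+ n))//.
by apply/funext => n /=; rewrite sumEFin.
Qed.

(** Since e^(-sn) >= - s n, a finite value would bound the mean of mu. *)
Lemma laplace_dilogarithm_neg (s : R) : s < 0 -> laplace eta s = +oo%E.
Proof.
move=> s0; rewrite laplace_dilogarithm.
set S := (\sum_(n <oo) _)%E.
have term0 n : (0 <= (fine (mu [set n]) * expR (- s) ^+ n)%:E)%E.
  by rewrite lee_fin mulr_ge0 ?fine_ge0 ?exprn_ge0 ?expR_ge0.
have S0 : (0 <= S)%E by apply: nneseries_ge0 => n _ _; exact: term0.
suff -> : S = +oo%E by rewrite gt0_muley// lte_fin expR_gt0.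
apply: contrapT => /eqP Sy.
have Sfin : S \is a fin_num by rewrite ge0_fin_numE// ltey.
have [N] := dilogarithm_infinite_mean (fine S / - s).
rewrite ltNge => /negP; apply.
rewrite ler_pdivlMr ?oppr_gt0// -lee_fin fineK//.
apply: le_trans (@nneseries_lim_ge _ _ _ 0%N N (fun n _ _ => term0 n)).
rewrite sumEFin lee_fin big_distrl/=; apply: ler_sum => n _.
rewrite -mulrA ler_wpM2l ?fine_ge0// -expRM_natr [n%:R * _]mulrC.
by have := expR_ge1Dx (- s * n%:R); lra.
Qed.

Lemma laplace_domE : laplace_dom eta = [set s | 0 < s].
Proof.
have [a ha] := laplace_dilogarithm_pos.
apply/seteqP; split => [s | s /= s0]; last first.
  apply: filterS (lt_nbhsr s0) => t /= /ha ->.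
  by rewrite ltry.
rewrite /laplace_dom /interior/= => /nbhs_ballP[e /= e0 he].
rewrite ltNge; apply/negP => s0.
(* A point s <= 0 of the interior would have s - e/2 < 0 in the domain. *)
have := he (s - e / 2); rewrite /ball/= opprB addrC subrK.
rewrite ger0_norm ?divr_ge0 ?ltW// ltr_pdivrMr// ltr_pMr// ltr1n => /(_ isT).
by rewrite laplace_dilogarithm_neg ?ltxx// subr_lt0 (le_lt_trans s0)// divr_gt0.
Qed.

(** * Means and variances *)

Lemma is_derive_log_laplace (s : R) : 0 < s ->
  is_derive s (1 : R) (log_laplace eta) (ln (expR s - 1)).
Proof.
have [a ha] := laplace_dilogarithm_pos; move=> s0.
apply: (near_eq_is_derive
  (f := fun s : R => s ^+ 2 / 2 + (a + polylog 2 (expR (- s))))).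
  near=> t; rewrite /log_laplace ha/= ?expRK//.
  by near: t; exact: lt_nbhsr.
have -> : ln (expR s - 1) = s + ln (1 - expR (- s)).
  rewrite -{2}[s]expRK -lnM ?posrE ?expR_gt0//.
    by rewrite mulrBr mulr1 expRxMexpNx_1.
  by rewrite subr_gt0 expR_lt1 oppr_lt0.
have d1 : is_derive s (1 : R) (fun s : R => s ^+ 2 / 2) s.
  by apply: is_derive_eq; rewrite /GRing.scale/=; field.
have d2 := is_derive_dilog_expR _ s0.
have d3 : is_derive s (1 : R) (fun s => a + polylog 2 (expR (- s)))
    (0 + ln (1 - expR (- s))).
  exact: is_deriveD.
by rewrite add0r in d3; exact: is_deriveD.
Unshelve. all: by end_near. Qed.

Lemma family_meanE (s : R) : 0 < s -> family_mean eta s = - ln (expR s - 1).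
Proof.
move=> /is_derive_log_laplace [_ ds].
by rewrite /family_mean derive1E ds.
Qed.

Lemma derive2_log_laplace (s : R) : 0 < s ->
  (log_laplace eta)^`(2)%classic s = expR s / (expR s - 1).
Proof.
move=> s0; rewrite derive1nS derive1n1 derive1E.
rewrite (@near_eq_derive _ _ _ _ (fun s => ln (expR s - 1))); last first.
  near=> t; rewrite derive1E; have t0 : 0 < t by near: t; exact: lt_nbhsr.
  by have [_ ->] := is_derive_log_laplace _ t0.
have es : 0 < expR s - 1 by rewrite subr_gt0 expR_gt1.
have d1 := is_derive1_ln es.
have d2 : is_derive s (1 : R) (fun s => expR s - 1) (expR s - 0).
  exact: is_deriveB.
have [_] := @is_derive1_comp _ (@ln R) (fun s => expR s - 1) _ _ _ d1 d2.
by rewrite subr0 mulrC => <-.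
Unshelve. all: by end_near. Qed.

Lemma family_mean_ln (m : R) : family_mean eta (ln (1 + expR (- m))) = m.
Proof.
have e0 := expR_gt0 (- m).
rewrite family_meanE; last by rewrite ln_gt0// ltrDl.
by rewrite lnK ?posrE ?addr_gt0// addrAC subrr add0r expRK opprK.
Qed.

Lemma mean_invE (m : R) : mean_inv eta m = ln (1 + expR (- m)).
Proof.
have inj : {in laplace_dom eta &, injective (family_mean eta)}.
  have ex (t : R) : 0 < t -> expR t - 1 \is Num.pos.
    by move=> t0; rewrite posrE subr_gt0 expR_gt1.
  move=> x y; rewrite !inE laplace_domE/= => x0 y0.
  rewrite !family_meanE// => /oppr_inj /(ln_inj (ex _ x0) (ex _ y0)).
  by move=> /addIr/expR_inj.
have dom : ln (1 + expR (- m)) \in laplace_dom eta.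
  by rewrite inE laplace_domE/= ln_gt0// ltrDl expR_gt0.
by have := pinvKV 0 inj dom; rewrite family_mean_ln.
Qed.

End dilogarithm_family.

Theorem mainTheorem9 (R : realType) (mu : probability nat R) :
  dilogarithm_distribution mu ->
  let eta := convolution (normal_prob 0 1) (on_real_line mu) in
  mean_domain eta = [set: R] /\
  (forall m : R, variance_function eta m = expR m + 1).
Proof.
move=> dmu eta; split => [|m].
  apply/seteqP; split => // m _; exists (ln (1 + expR (- m))).
    by rewrite laplace_domE//= ln_gt0// ltrDl expR_gt0.
  exact: family_mean_ln.
have e0 := expR_gt0 (- m).
rewrite /variance_function mean_invE// derive2_log_laplace//; last first.
  by rewrite ln_gt0// ltrDl.
rewrite lnK ?posrE ?addr_gt0// addrAC subrr add0r.
by rewrite mulrDl divff ?gt_eqF// mul1r -expRN opprK.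
Qed.
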